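(* For every $\mathsf{u}\in\mathcal{A}$, the set of equitable partitions of $\mathsf{u}$ forms a distributive lattice under the componentwise order. Its minimal element is the leftmost equitable partition of $\mathsf{u}$ and its maximal element is the rightmost equitable partition of $\mathsf{u}$.
   Context: Fix positive integers $m,N$. Let $\mathcal{A}$ be the set of words $\mathsf{u}=\mathsf{u}_1\cdots\mathsf{u}_N$ of length $N$ over $\{0,1,\ldots,m-1\}$; write $|\mathsf{u}|=\sum_i\mathsf{u}_i$ and $|\mathsf{u}|_m=|\mathsf{u}|\bmod m$. A partitioned word of $\mathsf{u}$ is a decomposition $\mathsf{u}^*=\mathsf{u}^*_{m-1}|\cdots|\mathsf{u}^*_0$ of $\mathsf{u}$ into $m$ possibly empty consecutive factors (blocks) whose concatenation is $\mathsf{u}$ (block $m-1$ leftmost, block $0$ rightmost); $\mathsf{block}(\mathsf{u}^*,i)=k$ if $\mathsf{u}_i$ lies in $\mathsf{u}^*_k$. The balancing array of $\mathsf{u}^*$ is the $N\times m$ array (rows $i=1..N$, columns $j=m-1,\ldots,0$) whose entry $(i,j)$ is filled iff $j\equiv\mathsf{block}(\mathsf{u}^*,i)-t\pmod m$ for some $0\le t\le\mathsf{u}_i-1$. Column $j$ is equitably filled if it has exactly $\lfloor|\mathsf{u}|/m\rfloor+1$ filled entries when $1\le j\le|\mathsf{u}|_m$ and exactly $\lfloor|\mathsf{u}|/m\rfloor$ when $j=0$ or $j>|\mathsf{u}|_m$; $\mathsf{u}^*$ is an equitable partition if all columns are equitably filled. The componentwise order: $\mathsf{u}^*\le\mathsf{v}^*$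 iff $\mathsf{block}(\mathsf{u}^*,i)\ge\mathsf{block}(\mathsf{v}^*,i)$ for all $i$. The leftmost (resp. rightmost) equitable partition of $\mathsf{u}$ is the equitable partition $\mathsf{u}^*$ such that every equitable partition $\mathsf{v}^*$ of $\mathsf{u}$ satisfies $\mathsf{block}(\mathsf{v}^*,i)\le\mathsf{block}(\mathsf{u}^*,i)$ (resp. $\ge$) for all $i$; both exist and are unique. *)

(* Defs.v *)
From mathcomp Require Import all_boot all_order.

Set Implicit Arguments.
Unset Strict Implicit.
Unset Printing Implicit Defensive.

(* Letters of a word are indexed from 0: row i of the array is i - 1 : 'I_N. *)

Section Partitions.

Variables (m N : nat) (u : N.-tuple 'I_m).

Definition weight : nat := \sum_(i < N) tnth u i.

(* The factors are listed from left to right, i.e. [:: u_(m-1); ...; u_0]. *)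
Definition partitioned_word : Type :=
  {p : m.-tuple (seq 'I_m) | flatten p == tval u}.

Implicit Types (p q : partitioned_word) (i : 'I_N) (j : 'I_m).

(* The factor at position k of the list is block number m - 1 - k. *)
Definition block p i : nat := m.-1 - reshape_index (shape (val p)) i.

(* j = block p i - t mod m, without truncated subtraction. *)
Definition filled p i j : bool :=
  [exists t : 'I_(tnth u i), j + t == block p i %[mod m]].

Definition equitably_filled p j : bool :=
  #|[set i | filled p i j]| ==
    (if 1 <= j <= weight %% m then (weight %/ m).+1 else weight %/ m).

Definition equitable p : bool := [forall j, equitably_filled p j].

Definition equitable_partition : Type :=
  {p : partitioned_word | equitable p}.

Definition componentwise_le p q : bool :=
  [forall i, block q i <= block p i].

Definition is_leftmost (p : equitable_partition) : Prop :=
  forall (q : equitable_partition) i, block (val q) i <= block (val p) i.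

Definition is_rightmost (p : equitable_partition) : Prop :=
  forall (q : equitable_partition) i, block (val p) i <= block (val q) i.

Definition equitable_le (p q : equitable_partition) : bool :=
  componentwise_le (val p) (val q).

End Partitions.

(* le is the order relation of some distrLatticeType structure on T. *)
Definition is_distr_lattice (T : Type) (le : rel T) : Prop :=
  exists (d : Order.disp_t) (c : Order.DistrLattice.axioms_ d T),
    forall x y : T, le x y = @Order.le d (Order.DistrLattice.Pack c) x y.

Definition is_minimum (T : Type) (le : rel T) (x : T) : Prop :=
  forall y : T, le x y.

Definition is_maximum (T : Type) (le : rel T) (x : T) : Prop :=
  forall y : T, le y x.

(* Main.v *)
(* Record a partitioned word by its weakly decreasing sequence b of blocks, and
   let h_j(b) be the number of filled cells of column j. Then
     h_j(b) + N
       = #{i | j <= b_i} + #{i | b_i < u_i + j} + #{i | b_i + m < u_i + j},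
   where the last two terms decrease when b grows. The sets {i | j <= b_i} are
   initial segments, hence totally ordered by inclusion: the first term of
   min(b, c) is that of b or of c, and for balanced b and c every column of
   min(b, c) has at least its target height. The heights sum to |u| whatever the
   blocks are, so min(b, c) is balanced; dually for max(b, c).

   For existence, start from b = 0 and raise letters one at a time as long as
   some column j > 0 with #{i | j <= b_i} < N is below its target. A column j > 0
   never exceeds its target except while #{i | j <= b_i} = 0. When no move is
   left, comparison with column 0 shows that all columns deviate from their
   targets in the same direction, so again the sum of the heights concludes. *)

From HB Require Import structures.
Require Import Defs.
From mathcomp Require Import all_boot all_order zify.

Set Implicit Arguments.
Unset Strict Implicit.
Unset Printing Implicit Defensive.

(** * Sums of indicators and positions in a flattened sequence *)

Lemma sum_leq_ord n c : \sum_(j < n) (c <= j) = n - c.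
Proof. by elim: n => [|n IH]; rewrite ?big_ord0 // big_ord_recr /= IH; lia. Qed.

Lemma eq_sum_leq n (F G : 'I_n -> nat) :
  (forall j, F j <= G j) -> \sum_j F j = \sum_j G j -> F =1 G.
Proof.
move=> leFG eqFG j; apply/eqP; rewrite eqn_leq leFG /=.
have : \sum_(k | k != j) F k <= \sum_(k | k != j) G k by apply: leq_sum.
by move: eqFG; rewrite (bigD1 j) //= [in RHS](bigD1 j) //=; lia.
Qed.

(** Recovers factor sizes from the indices of positions. Induction on the shape: the first [s]
    positions have index 0, the others are successors of indices for the tail. *)
Lemma count_reshape_index sh k :
  count_mem k [seq reshape_index sh i | i <- iota 0 (sumn sh)] = nth 0 sh k.
Proof.
elim: sh k => [|s sh IHsh] k; first by rewrite nth_nil.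
have -> : [seq reshape_index (s :: sh) i | i <- iota 0 (sumn (s :: sh))] =
    nseq s 0 ++ map S [seq reshape_index sh i | i <- iota 0 (sumn sh)].
  rewrite /= iotaD map_cat add0n; congr (_ ++ _).
    apply: (@eq_from_nth _ 0) => [|i].
      by rewrite size_map size_iota size_nseq.
    rewrite size_map size_iota => lt_i; rewrite (nth_map 0) ?size_iota //.
    by rewrite nth_iota // nth_nseq lt_i /reshape_index /= add0n subn_eq0 lt_i.
  rewrite -[s in iota s _]addn0 iotaDl -!map_comp; apply: eq_map => i /=.
  by rewrite /reshape_index /= -addnS addKn.
rewrite count_cat count_map count_nseq.
case: k => [|k] /=.
  by rewrite mul1n (@eq_count _ _ pred0) ?count_pred0 ?addn0.
by rewrite mul0n add0n -IHsh; apply: eq_count => i /=; rewrite eqSS.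
Qed.

Lemma reshape_index_homo sh :
  {homo reshape_index sh : i j / i <= j}.
Proof.
by move=> i j; rewrite (reshape_leq sh) => /orP[/ltnW|/andP[/eqP->]].
Qed.

(** * Partitioned words as weakly decreasing block functions *)

Section Partitions.

Variables (m N : nat) (u : N.-tuple 'I_m).
Implicit Types (p q : partitioned_word u) (i : 'I_N) (b c : 'I_N -> nat).

Definition block_function b : Prop :=
  (forall i, b i < m) /\ {homo b : i j / i <= j >-> j <= i}.

Lemma sumn_shape p : sumn (shape (val p)) = N.
Proof. by rewrite -size_flatten (eqP (valP p)) size_tuple. Qed.

Lemma reshape_index_shape p i : reshape_index (shape (val p)) i < m.
Proof.
by have := @reshape_indexP (shape (val p)) i;
  rewrite sumn_shape size_map size_tuple; apply.
Qed.

Lemma block_functionP p : block_function (block p).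
Proof.
split=> [i|i j le_ij].
  by have := reshape_index_shape p i; rewrite /block; lia.
by have := reshape_index_homo (shape (val p)) le_ij; rewrite /block; lia.
Qed.

(** Counting the letters of each block recovers the factor sizes, and the sizes determine the
    factors since both concatenations equal [u]. *)
Lemma block_inj p q : block p =1 block q -> p = q.
Proof.
move=> eq_pq.
have eq_sh : shape (val p) = shape (val q).
  apply: (@eq_from_nth _ 0) => [|k _]; first by rewrite !size_map !size_tuple.
  rewrite -!count_reshape_index !sumn_shape; congr (count _ _).
  apply/eq_in_map => i; rewrite mem_iota /= add0n => lt_iN.
  have := eq_pq (Ordinal lt_iN); rewrite /block /=.
  have := reshape_index_shape p (Ordinal lt_iN).
  have := reshape_index_shape q (Ordinal lt_iN); rewrite /=; lia.
apply/val_inj/val_inj; rewrite /= -[LHS]flattenK -[RHS]flattenK eq_sh.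
by rewrite (eqP (valP p)) (eqP (valP q)).
Qed.

(** Cut [u] into factors whose sizes [sh] are the multiplicities in [w], the list of required factor
    positions. The positions [E] obtained have the same multiplicities as [w], and both lists are
    sorted, so they coincide. *)
Lemma block_function_partition b :
  block_function b -> exists p, block p =1 b.
Proof.
move=> [lt_bm homo_b].
pose w := [seq m.-1 - b i | i <- enum 'I_N].
have size_w : size w = N by rewrite size_map size_enum_ord.
have nth_w i : nth 0 w i = m.-1 - b i.
  by rewrite (nth_map i) ?size_enum_ord // nth_ord_enum.
pose sh := mkseq (fun k => count_mem k w) m.
have ws : {in w, forall k, k < m}.
  by move=> k /mapP[i _ ->]; have := lt_bm i; lia.
have count_w k : count_mem k w = nth 0 sh k.
  case: (ltnP k m) => [lt_km|le_mk]; first by rewrite nth_mkseq.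
  rewrite nth_default ?size_mkseq //; apply/eqP; rewrite eqn0Ngt -has_count.
  by apply/hasPn => l /ws; rewrite /= neq_ltn => /leq_trans->.
pose E := [seq reshape_index sh k | k <- iota 0 (sumn sh)].
have perm_Ew : perm_eq E w.
  by apply/allP => k _; rewrite /= count_reshape_index count_w.
have sumn_sh : sumn sh = N.
  by rewrite -size_w -(perm_size perm_Ew) size_map size_iota.
have eq_Ew : E = w.
  apply: (sorted_eq leq_trans anti_leq) perm_Ew.
    apply: (homo_sorted (@reshape_index_homo sh)); exact: iota_sorted.
  apply: (homo_sorted_in (e := fun i j : 'I_N => i <= j) (P := predT))
    => [|//|].
  - by move=> i j _ _ /= /homo_b; lia.
  - exact/allP.
  - by rewrite -(@sorted_map _ _ val leq) val_enum_ord iota_sorted.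
have fl : flatten (reshape sh u) == u by rewrite reshapeKr ?size_tuple ?sumn_sh.
have sz : size (reshape sh u) == m by rewrite size_reshape size_mkseq.
exists (exist _ (Tuple sz) fl) => i; rewrite /block /=.
rewrite reshapeKl ?size_tuple ?sumn_sh //.
have := nth_w i; rewrite -eq_Ew (nth_map 0) ?size_iota ?sumn_sh //.
by rewrite nth_iota // add0n => ->; have := lt_bm i; lia.
Qed.

(** * Column heights, targets and their totals *)

Definition height b j : nat :=
  \sum_(i < N) ((j <= b i < tnth u i + j) || (b i + m < tnth u i + j)).

Definition target j : nat :=
  if 1 <= j <= weight u %% m then (weight u %/ m).+1 else weight u %/ m.

Definition balanced b : Prop := forall j, j < m -> height b j = target j.

(** As [j + t] is below [2 * m], the congruence leaves two cases: [j + t] is the block itself, or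
    the block plus [m] when the filling wraps around. *)
Lemma filledE p i (j : 'I_m) :
  filled p i j =
  (j <= block p i < tnth u i + j) || (block p i + m < tnth u i + j).
Proof.
have lt_bm := (block_functionP p).1 i.
have lt_jm := ltn_ord j; have lt_um := ltn_ord (tnth u i).
apply/existsP/idP => [[t]|].
  have := ltn_ord t; move: (nat_of_ord t) => {}t lt_tu.
  rewrite (modn_small lt_bm); case: (ltnP (j + t) m) => [lt|ge].
    by rewrite modn_small // => /eqP<-; lia.
  rewrite -(subnK ge) modnDr modn_small; last lia.
  by move=> /eqP<-; lia.
case: (leqP j (block p i)) => [le_jb|lt_bj].
  move=> le_u; have lt_t : block p i - j < tnth u i by lia.
  by exists (Ordinal lt_t); rewrite /= subnKC.
rewrite /= => lt_bu; have lt_t : block p i + m - j < tnth u i by lia.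
by exists (Ordinal lt_t); rewrite /= subnKC ?modnDr //; lia.
Qed.

Lemma equitableP p : reflect (balanced (block p)) (equitable p).
Proof.
have card_height (j : 'I_m) : #|[set i | filled p i j]| = height (block p) j.
  rewrite -sum1_card big_mkcond /=; apply: eq_bigr => i _.
  by rewrite inE filledE; case: ifP.
apply: (iffP forallP) => [eq_p j lt_jm|bal_p j].
  by have /eqP := eq_p (Ordinal lt_jm); rewrite card_height.
by rewrite /equitably_filled card_height bal_p.
Qed.

Definition starts b j : nat := \sum_(i < N) (j <= b i).

Definition ends b j : nat :=
  \sum_(i < N) ((b i < tnth u i + j) + (b i + m < tnth u i + j)).

(** Holds letter by letter. If [j <= b i], the wrapped indicator vanishes because letters are below
    [m]; otherwise [b i < tnth u i + j] is automatic and contributes the 1 counted by [N]. *)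
Lemma heightD b j :
  block_function b -> j < m -> height b j + N = starts b j + ends b j.
Proof.
move=> [lt_bm _] lt_jm.
rewrite -[X in _ + X = _]card_ord -sum1_card -!big_split /=.
by apply: eq_bigr => i _; have := lt_bm i; have := ltn_ord (tnth u i); lia.
Qed.

Lemma leq_ends b c j : (forall i, b i <= c i) -> ends c j <= ends b j.
Proof. by move=> le_bc; apply: leq_sum => i _; have := le_bc i; lia. Qed.

Lemma sum_height b : block_function b -> \sum_(j < m) height b j = weight u.
Proof.
move=> [lt_bm _]; rewrite exchange_big /=; apply: eq_bigr => i _.
set a : nat := tnth u i; have lt_am : a < m by exact: ltn_ord.
(* The added term counts the columns beyond [b i]. With it, the sum splits into indicators of the
   form [c <= j], which [sum_leq_ord] evaluates. *)
have lt_b := lt_bm i; apply: (@addIn (m - (b i).+1)).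
transitivity (m - ((b i).+1 - a) + (m - ((b i + m).+1 - a))); last lia.
by rewrite -!(sum_leq_ord m) -!big_split /=; apply: eq_bigr => j _; lia.
Qed.

Lemma sum_target : 0 < m -> \sum_(j < m) target j = weight u.
Proof.
move=> m_gt0; set r := weight u %% m; have lt_rm : r < m by exact: ltn_pmod.
(* Same device: adding the indicator of [r < j] to [target j] gives the quotient plus the indicator
   of [1 <= j]. *)
apply: (@addIn (m - r.+1)).
transitivity (m * (weight u %/ m) + (m - 1)).
  have <- : \sum_(j < m) (weight u %/ m) = m * (weight u %/ m).
    by rewrite sum_nat_const card_ord.
  rewrite -!(sum_leq_ord m) -!big_split /=.
  by apply: eq_bigr => j _; rewrite /target -/r; case: ifP; lia.
by rewrite [in RHS](divn_eq (weight u) m) -/r; lia.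
Qed.

Lemma balanced_le b : 0 < m -> block_function b ->
  (forall j, j < m -> height b j <= target j) -> balanced b.
Proof.
move=> m_gt0 block_b le_ht j lt_jm.
apply: (@eq_sum_leq m (height b) target _ _ (Ordinal lt_jm)) => [k|].
  exact: le_ht.
by rewrite sum_height ?sum_target.
Qed.

Lemma balanced_ge b : 0 < m -> block_function b ->
  (forall j, j < m -> target j <= height b j) -> balanced b.
Proof.
move=> m_gt0 block_b le_th j lt_jm; apply/esym.
apply: (@eq_sum_leq m target (height b) _ _ (Ordinal lt_jm)) => [k|].
  exact: le_th.
by rewrite sum_height ?sum_target.
Qed.

(** * Stability of balance under pointwise minimum and maximum *)

Lemma block_function_total b c j : block_function b -> block_function c ->
  (forall i, j <= b i -> j <= c i) \/ (forall i, j <= c i -> j <= b i).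
Proof.
move=> [_ homo_b] [_ homo_c].
case: (boolP [forall i, (j <= b i) ==> (j <= c i)]) => [/forallP sub_bc|].
  by left=> i; exact/implyP.
rewrite negb_forall => /existsP[i]; rewrite negb_imply -ltnNge => /andP[jb cj].
right=> k jc; case: (leqP i k) => [/homo_c|/ltnW/homo_b]; lia.
Qed.

(** Lowering blocks can only raise [ends], and the last hypothesis keeps [starts] in column [j] from
    dropping. *)
Lemma leq_height b c j : block_function b -> block_function c -> j < m ->
  (forall i, c i <= b i) -> (forall i, j <= b i -> j <= c i) ->
  height b j <= height c j.
Proof.
move=> block_b block_c lt_jm le_cb sub_bc; rewrite -(leq_add2r N) !heightD //.
apply: leq_add; last exact: leq_ends.
by apply: leq_sum => i _; have := sub_bc i; lia.
Qed.

Lemma block_function_min b c : block_function b -> block_function c ->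
  block_function (fun i => minn (b i) (c i)).
Proof.
move=> [lt_b homo_b] [lt_c homo_c]; split=> [i|i k le_ik].
  by have := lt_b i; lia.
by have := homo_b _ _ le_ik; have := homo_c _ _ le_ik; lia.
Qed.

Lemma block_function_max b c : block_function b -> block_function c ->
  block_function (fun i => maxn (b i) (c i)).
Proof.
move=> [lt_b homo_b] [lt_c homo_c]; split=> [i|i k le_ik].
  by have := lt_b i; have := lt_c i; lia.
by have := homo_b _ _ le_ik; have := homo_c _ _ le_ik; lia.
Qed.

Lemma balanced_min b c : 0 < m ->
  block_function b -> block_function c -> balanced b -> balanced c ->
  balanced (fun i => minn (b i) (c i)).
Proof.
move=> m_gt0 block_b block_c bal_b bal_c.
have block_bc := block_function_min block_b block_c.
apply: balanced_ge => // j lt_jm.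
case: (block_function_total j block_b block_c) => sub.
  rewrite -(bal_b j lt_jm); apply: leq_height => // i; first exact: geq_minl.
  by have := sub i; lia.
rewrite -(bal_c j lt_jm); apply: leq_height => // i; first exact: geq_minr.
by have := sub i; lia.
Qed.

Lemma balanced_max b c : 0 < m ->
  block_function b -> block_function c -> balanced b -> balanced c ->
  balanced (fun i => maxn (b i) (c i)).
Proof.
move=> m_gt0 block_b block_c bal_b bal_c.
have block_bc := block_function_max block_b block_c.
apply: balanced_le => // j lt_jm.
case: (block_function_total j block_b block_c) => sub.
  rewrite -(bal_c j lt_jm); apply: leq_height => // i; first exact: leq_maxr.
  by have := sub i; lia.
rewrite -(bal_b j lt_jm); apply: leq_height => // i; first exact: leq_maxl.
by have := sub i; lia.
Qed.

(** * Existence of a balanced block function *)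

Lemma leq_ends_col b j k : j <= k -> ends b j <= ends b k.
Proof. by move=> le_jk; apply: leq_sum => i _; lia. Qed.

(** For each letter, the first indicator in column [j] is at most 1, and since [j <= m] the second
    one implies [b i < tnth u i]. *)
Lemma ends_wrap b j : j <= m -> ends b j <= N + ends b 0.
Proof.
move=> le_jm; rewrite -[N in N + _]card_ord -sum1_card -big_split /=.
by apply: leq_sum => i _; lia.
Qed.

Lemma starts0 b : starts b 0 = N.
Proof. by rewrite /starts sum1_card card_ord. Qed.

Lemma leq_target j k : 0 < j <= k -> target k <= target j.
Proof. by rewrite /target; do 2?case: ifP; lia. Qed.

Lemma target0 j : target 0 <= target j <= (target 0).+1.
Proof. by rewrite /target /=; case: ifP; lia. Qed.

Local Notation "[ 'fn' b ]" := (fun i => nat_of_ord (fun_of_fin b i)).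

Lemma block_function_ffunP (b : {ffun 'I_N -> 'I_m}) :
  reflect (block_function [fn b])
    [forall i : 'I_N, forall k : 'I_N, (i <= k) ==> (b k <= b i)].
Proof.
apply: (iffP forallP) => [homo_b|[_ homo_b] i].
  by split=> // i k le_ik; have /forallP/(_ k)/implyP := homo_b i; apply.
by apply/forallP=> k; apply/implyP/homo_b.
Qed.

(** The first letter in a block below [j] moves up by one block; earlier letters are in blocks at
    least [j], so monotonicity survives. Only its new column gains a start. The bound on [starts]
    preserves the exemption of columns without starts in [exists_balanced]. *)
Lemma raise_column (b : {ffun 'I_N -> 'I_m}) j :
    block_function [fn b] -> 0 < j < m ->
    height [fn b] j < target j -> starts [fn b] j < N ->
  exists c : {ffun 'I_N -> 'I_m},
    [/\ block_function [fn c], \sum_i b i < \sum_i c i &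
     forall l, 0 < l < m -> height [fn c] l <= target l \/
       height [fn c] l <= height [fn b] l /\
       starts [fn c] l <= starts [fn b] l].
Proof.
move=> block_b /andP[j_gt0 lt_jm] lt_ht lt_startsN.
have [_ homo_b] := block_b.
have /existsP[i1 lt_bj] : [exists i, b i < j].
  apply: contraLR lt_startsN; rewrite negb_exists => /forallP ge_bj.
  rewrite -leqNgt -[leqLHS]card_ord -sum1_card.
  by apply: leq_sum => i _; have := ge_bj i; rewrite -leqNgt => ->.
case: (@arg_minnP _ i1 (fun i => b i < j) val lt_bj) => i0 lt_b0j min_i0.
have lt_v : (b i0).+1 < m by lia.
pose c : {ffun 'I_N -> 'I_m} :=
  [ffun i => if i == i0 then Ordinal lt_v else b i].
have cE i : c i = b i + (i == i0) :> nat.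
  by rewrite ffunE; case: eqP => [->|_]; rewrite ?addn1 ?addn0.
have sum_i0 : \sum_(i < N) (i == i0 : nat) = 1.
  by rewrite (bigD1 i0) //= eqxx big1 // => i /negbTE->.
have block_c : block_function [fn c].
  split=> // i k le_ik; rewrite !cE; have := homo_b _ _ le_ik.
  case: (eqVneq k i0) => [eq_k|_]; last by rewrite /=; lia.
  case: (eqVneq i i0) => [->|ne_i _]; first by rewrite eq_k.
  have lt_i : i < i0.
    by rewrite ltn_neqAle -eq_k le_ik eq_k (inj_eq val_inj) ne_i.
  case: (leqP j (b i)) => [|/min_i0]; last by rewrite /= leqNgt lt_i.
  by rewrite eq_k /=; lia.
exists c; split=> //.
  by rewrite (eq_bigr _ (fun i _ => cE i)) big_split /= sum_i0 addn1.
move=> l /andP[l_gt0 lt_lm].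
case: (eqVneq l (b i0).+1) => [eq_l|ne_l]; last first.
  have sub_cb i : l <= c i -> l <= b i.
    by rewrite cE; case: (eqVneq i i0) => [->|_]; lia.
  right; split; last by apply: leq_sum => i _; have := sub_cb i; lia.
  by apply: leq_height => // i; rewrite cE leq_addr.
left; apply: (@leq_trans (target j)); last by apply: leq_target; lia.
(* No letter lies in blocks (b i0).+1 .. j - 1, so column l starts as many
   letters as column j, and column j is below its target. *)
have starts_l : starts [fn c] l <= starts [fn b] j + 1.
  rewrite -sum_i0 -big_split /=; apply: leq_sum => i _; rewrite cE.
  case: (leqP j (b i)) => [|/min_i0 /homo_b]; lia.
have ends_l : ends [fn c] l <= ends [fn b] j.
  apply: leq_trans (leq_ends_col _ (_ : l <= j)); last lia.
  by apply: leq_ends => i; rewrite cE leq_addr.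
by have := heightD block_c lt_lm; have := heightD block_b lt_jm; lia.
Qed.

(** Column 0 decides the direction, as its height is [ends b 0]. A column without starts is at most
    that high, by [ends_wrap]; one with [N] starts is at least that high. If column 0 exceeds its
    target, the excess of at least 1 absorbs the gap allowed by [target0]. *)
Lemma saturated_balanced b : 0 < m -> block_function b ->
    (forall j, 0 < j < m -> height b j <= target j \/ starts b j = 0) ->
    (forall j, 0 < j < m -> starts b j < N -> target j <= height b j) ->
  balanced b.
Proof.
move=> m_gt0 block_b le_ht ge_ht.
have h0 := heightD block_b m_gt0; rewrite starts0 in h0.
case: (leqP (height b 0) (target 0)) => [le0|gt0].
  apply: balanced_le => // -[//|j] lt_jm; have [//|s0] := le_ht j.+1 lt_jm.
  have := heightD block_b lt_jm; have := ends_wrap b (ltnW lt_jm).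
  by have := target0 j.+1; lia.
apply: balanced_ge => // -[_|j lt_jm]; first exact: ltnW.
case: (ltnP (starts b j.+1) N) => [/ge_ht -> //|ge_s].
have := heightD block_b lt_jm; have := leq_ends_col b (leq0n j.+1).
by have := target0 j.+1; lia.
Qed.

(** The iteration becomes a choice of [b] with largest block sum subject to the invariant [P]:
    another raise would preserve [P] and increase the sum. *)
Lemma exists_balanced : 0 < m -> exists2 b, block_function b & balanced b.
Proof.
move=> m_gt0.
pose P (b : {ffun 'I_N -> 'I_m}) :=
  [forall i : 'I_N, forall k : 'I_N, (i <= k) ==> (b k <= b i)] &&
  [forall j : 'I_m, (0 < j) ==>
    ((height [fn b] j <= target j) || (starts [fn b] j == 0))].
(* The constant 0 may overfill positive columns by wrapping, but no letter starts there, so the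
   exemption in [P] applies. *)
have P0 : P [ffun=> Ordinal m_gt0].
  apply/andP; split.
    by apply/block_function_ffunP; split=> // i k _; rewrite !ffunE.
  apply/forallP => j; apply/implyP => j_gt0; apply/orP; right.
  by apply/eqP/big1 => i _; rewrite ffunE leqNgt j_gt0.
case: (@arg_maxnP _ _ P (fun b : {ffun 'I_N -> 'I_m} => \sum_i b i) P0).
move=> b /andP[/block_function_ffunP block_b /forallP Pb] max_b.
have ge_ht j : 0 < j < m -> starts [fn b] j < N -> target j <= height [fn b] j.
  move=> lt_jm lt_sN; rewrite leqNgt; apply/negP => lt_ht.
  have [c [block_c lt_bc le_c]] := raise_column block_b lt_jm lt_ht lt_sN.
  suff /max_b : P c by rewrite /= leqNgt lt_bc.
  apply/andP; split; first exact/block_function_ffunP.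
  apply/forallP => l; apply/implyP => l_gt0.
  have := Pb l; rewrite l_gt0 /= => /orP.
  by have := le_c l; rewrite l_gt0 ltn_ord => /(_ isT); lia.
exists [fn b] => //; apply: saturated_balanced => // j /andP[j_gt0 lt_jm].
by have := Pb (Ordinal lt_jm); rewrite /= j_gt0 => /orP[|/eqP]; [left|right].
Qed.

(** * Greatest and least balanced block functions *)

Definition balanced_ffun (b : {ffun 'I_N -> 'I_m}) : bool :=
  [forall i : 'I_N, forall k : 'I_N, (i <= k) ==> (b k <= b i)] &&
  [forall j : 'I_m, height [fn b] j == target j].

Lemma balanced_ffunP (b : {ffun 'I_N -> 'I_m}) :
  reflect (block_function [fn b] /\ balanced [fn b]) (balanced_ffun b).
Proof.
apply: (iffP andP) => -[/block_function_ffunP block_b bal_b]; split=> //.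
  by move=> j lt_jm; have /forallP/(_ (Ordinal lt_jm))/eqP := bal_b.
by apply/forallP => j; rewrite bal_b.
Qed.

Lemma exists_balanced_ffun b : block_function b -> balanced b ->
  exists2 c, balanced_ffun c & [fn c] =1 b.
Proof.
move=> block_b bal_b; have [lt_bm homo_b] := block_b.
pose c := [ffun i => Ordinal (lt_bm i)].
have cE i : c i = b i :> nat by rewrite ffunE.
exists c => //; apply/balanced_ffunP; split.
  by split=> // i k /homo_b; rewrite !cE.
by move=> j /bal_b <-; apply: eq_bigr => i _; rewrite cE.
Qed.

(** Take [b] of largest block sum. Its maximum with any balanced [c] is balanced and dominates [b],
    hence has the same sum and equals [b]. *)
Lemma exists_greatest_balanced : 0 < m ->
  exists b, [/\ block_function b, balanced b &
    forall c, block_function c -> balanced c -> forall i, c i <= b i].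
Proof.
move=> m_gt0; have [b0 block_b0 bal_b0] := exists_balanced m_gt0.
have [c0 Pc0 _] := exists_balanced_ffun block_b0 bal_b0.
case: (@arg_maxnP _ _ _ (fun b : {ffun 'I_N -> 'I_m} => \sum_i b i) Pc0).
move=> b /balanced_ffunP[block_b bal_b] max_b.
exists [fn b]; split=> // c block_c bal_c i.
have [d /max_b /= le_db dE] := exists_balanced_ffun
  (block_function_max block_b block_c)
  (balanced_max m_gt0 block_b block_c bal_b bal_c).
have le_bd k : b k <= d k by rewrite dE leq_maxl.
have eq_bd : \sum_i b i = \sum_i d i.
  by apply/eqP; rewrite eqn_leq le_db andbT; apply: leq_sum.
by rewrite (eq_sum_leq le_bd eq_bd) dE leq_maxr.
Qed.

Lemma exists_least_balanced : 0 < m ->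
  exists b, [/\ block_function b, balanced b &
    forall c, block_function c -> balanced c -> forall i, b i <= c i].
Proof.
move=> m_gt0; have [b0 block_b0 bal_b0] := exists_balanced m_gt0.
have [c0 Pc0 _] := exists_balanced_ffun block_b0 bal_b0.
case: (@arg_minnP _ _ _ (fun b : {ffun 'I_N -> 'I_m} => \sum_i b i) Pc0).
move=> b /balanced_ffunP[block_b bal_b] min_b.
exists [fn b]; split=> // c block_c bal_c i.
have [d /min_b /= le_bd dE] := exists_balanced_ffun
  (block_function_min block_b block_c)
  (balanced_min m_gt0 block_b block_c bal_b bal_c).
have le_db k : d k <= b k by rewrite dE geq_minl.
have eq_db : \sum_i d i = \sum_i b i.
  by apply/eqP; rewrite eqn_leq le_bd andbT; apply: leq_sum.
by rewrite -(eq_sum_leq le_db eq_db) dE geq_minr.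
Qed.

Lemma balanced_equitable b : block_function b -> balanced b ->
  exists p : equitable_partition u, block (val p) =1 b.
Proof.
move=> block_b bal_b; have [p pE] := block_function_partition block_b.
suff eq_p : equitable p by exists (exist _ p eq_p).
apply/equitableP => j /bal_b <-; apply: eq_bigr => i _; by rewrite pE.
Qed.

End Partitions.

(** * Transfer to the lattice structure and conclusion *)

(** The order reverses [f], so the meet is the pointwise maximum and the join the minimum;
    injectivity of [f] reduces every law to one on natural numbers. *)
Lemma is_distr_lattice_minmax (T : choiceType) (I : finType) (f : T -> I -> nat)
    (le : rel T) :
    (forall x y, f x =1 f y -> x = y) ->
    (forall x y, le x y = [forall i, f y i <= f x i]) ->
    (forall x y, exists z, forall i, f z i = minn (f x i) (f y i)) ->
    (forall x y, exists z, forall i, f z i = maxn (f x i) (f y i)) ->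
  is_distr_lattice le.
Proof.
move=> f_inj leE ex_min ex_max.
(* The boolean form allows [xchoose] to turn existence into operations. *)
have ex_minb x y : exists z, [forall i, f z i == minn (f x i) (f y i)].
  by have [z zE] := ex_min x y; exists z; apply/forallP => i; rewrite zE.
have ex_maxb x y : exists z, [forall i, f z i == maxn (f x i) (f y i)].
  by have [z zE] := ex_max x y; exists z; apply/forallP => i; rewrite zE.
pose meet x y := xchoose (ex_maxb x y); pose join x y := xchoose (ex_minb x y).
have meetE x y i : f (meet x y) i = maxn (f x i) (f y i).
  by have /forallP/(_ i)/eqP := xchooseP (ex_maxb x y).
have joinE x y i : f (join x y) i = minn (f x i) (f y i).
  by have /forallP/(_ i)/eqP := xchooseP (ex_minb x y).
have le_def x y : le x y = (meet x y == x).
  rewrite leE; apply/forallP/eqP => [le_yx|<- i]; last first.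
    by rewrite meetE leq_maxr.
  by apply: f_inj => i; rewrite meetE; apply/maxn_idPl.
have meetC : commutative meet.
  by move=> x y; apply: f_inj => i; rewrite !meetE maxnC.
have joinC : commutative join.
  by move=> x y; apply: f_inj => i; rewrite !joinE minnC.
have meetA : associative meet.
  by move=> x y z; apply: f_inj => i; rewrite !meetE maxnA.
have joinA : associative join.
  by move=> x y z; apply: f_inj => i; rewrite !joinE minnA.
have joinKI y x : meet x (join x y) = x.
  by apply: f_inj => i; rewrite meetE joinE; lia.
have meetKU y x : join x (meet x y) = x.
  by apply: f_inj => i; rewrite joinE meetE; lia.
have meetUl : left_distributive meet join.
  by move=> x y z; apply: f_inj => i; rewrite !(meetE, joinE); lia.
have meetxx : idempotent_op meet.
  by move=> x; apply: f_inj => i; rewrite meetE maxnn.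
(* The Build abbreviation fails on a variable of type choiceType: it looks for
   T as an explicit Choice.Pack. *)
pose A := @Order.isMeetJoinDistrLattice.Axioms_ (Order.Disp tt tt) T
    (Choice.class T) (Choice.class T) le _ meet join le_def (fun _ _ => erefl)
    meetC joinC meetA joinA joinKI meetKU meetUl meetxx.
pose L := HB.pack_for (distrLatticeType (Order.Disp tt tt)) T A.
by exists (Order.Disp tt tt), (Order.DistrLattice.class L).
Qed.

Theorem theorem5p8 (m N : nat) (m_gt0 : 0 < m) (N_gt0 : 0 < N)
    (u : N.-tuple 'I_m) :
  [/\ is_distr_lattice (@equitable_le m N u),
      exists2 l : equitable_partition u,
        unique (@is_leftmost m N u) l & is_minimum (@equitable_le m N u) l
    & exists2 r : equitable_partition u,
        unique (@is_rightmost m N u) r & is_maximum (@equitable_le m N u) r].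
Proof.
pose f (p : equitable_partition u) := block (val p).
have f_inj p q : f p =1 f q -> p = q.
  by move=> eq_pq; apply/val_inj/block_inj.
have block_f p : block_function m (f p) by apply: block_functionP.
have bal_f p : balanced u (f p) by exact/equitableP/(valP p).
split.
- apply: (is_distr_lattice_minmax f_inj) => // p q; apply: balanced_equitable.
  + exact: block_function_min.
  + exact: balanced_min.
  + exact: block_function_max.
  + exact: balanced_max.
(* Blocks are numbered from right to left, so the leftmost partition has the greatest block
   function. *)
- have [b [block_b bal_b max_b]] := exists_greatest_balanced u m_gt0.
  have [l lE] := balanced_equitable block_b bal_b.
  have left_l : is_leftmost l by move=> q i; rewrite lE; apply: (max_b (f q)).
  exists l; last by move=> q; apply/forallP => i; apply: left_l.
  split=> // l' left_l'; apply: f_inj => i.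
  by apply/eqP; rewrite eqn_leq left_l left_l'.
- have [b [block_b bal_b min_b]] := exists_least_balanced u m_gt0.
  have [r rE] := balanced_equitable block_b bal_b.
  have right_r : is_rightmost r by move=> q i; rewrite rE; apply: (min_b (f q)).
  exists r; last by move=> q; apply/forallP => i; apply: right_r.
  split=> // r' right_r'; apply: f_inj => i.
  by apply/eqP; rewrite eqn_leq right_r right_r'.
Qed.
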